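(* Let $S$ be compact, $\mu,c\in C(S)$, $\mathcal{A}=\mathcal{B}=\{c\}$ and $q\in\mathbb{R}$. Assume conditions (A1) and (A2) (given in the context) for some $\tilde\eta>0$. Then $$\liminf_{N\to\infty}\mathbb{P}_*\Big[\hat{\mathcal{U}}_{c+q\tau_N\sigma}\subseteq\mathcal{U}_c\ \wedge\ \hat{\mathcal{L}}_{c-q\tau_N\sigma}\subseteq\mathcal{L}_c\Big]\ge\mathbb{P}\big[T_c(G)<q\big]$$ and $$\limsup_{N\to\infty}\mathbb{P}^*\Big[\hat{\mathcal{U}}_{c+q\tau_N\sigma}\subseteq\mathcal{U}_c\ \wedge\ \hat{\mathcal{L}}_{c-q\tau_N\sigma}\subseteq\mathcal{L}_c\Big]\le\mathbb{P}\big[T_c(G)\le q\big].$$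
   Context: $(S,d)$ is a metric space, $C(S)$ the continuous real functions on $S$, $(\Omega,\mathfrak{P},\mathbb{P})$ a probability space, and $\mathbb{P}_*,\mathbb{P}^*$ denote inner and outer probability. $\mathcal{F}(S)$ is the set of all functions $S\to\mathbb{R}\cup\{\pm\infty\}$, $\ell^\infty(S)$ the bounded real functions with the supremum norm. Convention: $\sup_\emptyset=-\infty$. Weak convergence $\rightsquigarrow$ is in the Hoffmann-J{\o}rgensen sense. A sequence of (not necessarily measurable) maps $X_N$ is asymptotically tight if for every $\epsilon>0$ there is a compact $C$ with $\liminf_N\mathbb{P}_*[X_N\in C^\delta]\ge1-\epsilon$ for all $\delta>0$, where $C^\delta$ is the open $\delta$-enlargement of $C$. For $\mathcal{H}\subseteq\mathcal{F}(S)$ and $\eta>0$: $\mathcal{H}_{\pm\eta}=\{h\pm\varepsilon: h\in\mathcal{H},\ 0\le\varepsilon\le\eta\}$. With $\mu$ the target function, $\mu^{-1}_{\mathcal{H}}=\{s\in S:\exists h\in\mathcal{H},\ \mu(s)=h(s)\}$ (written $\mu^{-1}_c$ for $\mathcal{H}=\{c\}$), and $\mathfrak{u}^{\pm}_{\mathcal{H}}=\bigcap_{\eta>0}\mathrm{cl}\,\mu^{-1}_{\mathcal{H}_{\pm\eta}}$. $\hat\mu_N:\Omega\to\ell^\infty(S)$ are (not necessarily measurable) estimators of $\mu$; $(\tau_N)$ is a positive real sequence converging to zero; $\sigma\in\ell^\infty(S)$ satisfies $0<\mathfrak{o}<\sigma(s)<\mathfrak{O}<\infty$ for all $s\in S$;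 $G_N=(\hat\mu_N-\mu)/(\tau_N\sigma)$. For $f\in\mathcal{F}(S)$: $\mathcal{L}_f=\{s:\mu(s)<f(s)\}$, $\mathcal{U}_f=\{s:\mu(s)>f(s)\}$, and $\hat{\mathcal{L}}_f,\hat{\mathcal{U}}_f$ are defined in the same way with $\hat\mu_N$ in place of $\mu$. $T_c(f)=\max\{\sup_{s\in\mu^{-1}_c}f(s),\ \sup_{s\in\mu^{-1}_c}-f(s)\}$. Assumptions (for a given $\tilde\eta>0$, $\mathcal{A},\mathcal{B}\subseteq\mathcal{F}(S)$): (A1) (i) There is a tight Borel measurable $G:\Omega\to\ell^\infty(\mathrm{cl}\,\mu^{-1}_{\mathcal{A}_{-\tilde\eta}}\cup\mathrm{cl}\,\mu^{-1}_{\mathcal{B}_{+\tilde\eta}})$ such that (the restriction of) $G_N\rightsquigarrow G$ weakly in that space. (ii) There are a constant $K>0$ and a sequence of functions $Z_N:\Omega\to\ell^\infty(S)$ with $\inf_{s\in S}\tau_N^{-1}Z_N(s)$ asymptotically tight such that, $\mathbb{P}_*$-almost surely, for all $a\in\mathcal{A}$ and $s\in S\setminus\mathrm{cl}\,\mu^{-1}_{\mathcal{A}_{-\tilde\eta}}$, $(\hat\mu_N(s)-a(s))\,\mathrm{sgn}(\mu(s)-a(s))\ge\sigma(s)(K+Z_N(s))$, and for all $b\in\mathcal{B}$ and $s\in S\setminus\mathrm{cl}\,\mu^{-1}_{\mathcal{B}_{+\tilde\eta}}$, $(\hat\mu_N(s)-b(s))\,\mathrm{sgn}(\mu(s)-b(s))\ge\sigma(s)(K+Z_N(s))$.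 (A2) $G$ and $G_N$ restricted to $(\mathrm{cl}\,\mu^{-1}_{\mathcal{A}_{-\tilde\eta}}\setminus\mathrm{int}\,\mathfrak{u}^-_{\mathcal{A}})\cup(\mathrm{cl}\,\mu^{-1}_{\mathcal{B}_{+\tilde\eta}}\setminus\mathrm{int}\,\mathfrak{u}^+_{\mathcal{B}})$ have almost surely continuous sample paths. *)

(* Defs.v *)
From HB Require Import structures.
From mathcomp Require Import all_boot all_order all_algebra.
From mathcomp Require Import all_classical all_reals all_analysis.
From mathcomp Require Import measurable_realfun.

Set Implicit Arguments.
Unset Strict Implicit.
Unset Printing Implicit Defensive.

Import Order.TTheory GRing.Theory Num.Theory.
Import numFieldNormedType.Exports.

Local Open Scope classical_set_scope.
Local Open Scope ring_scope.

Record linfty (T : Type) (R : realType) := Linfty {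
  linfty_fun :> T -> R ;
  linfty_bounded : bounded_fun linfty_fun }.

(* The supremum is taken in R, so the norm on functions over an empty [T]
   is [sup set0 = 0], as it should be. *)
Definition sup_norm (T : Type) (R : realType) (f : T -> R) : R :=
  sup [set `|f t| | t in [set: T]].

Section linfty_metric.
Context (T : Type) (R : realType).
Implicit Types f g h : linfty T R.

Definition linfty_dist f g : R := sup_norm (fun t => f t - g t).

Lemma linfty_dist_has_ubound f g :
  has_ubound [set `|f t - g t| | t in [set: T]].
Proof.
have [M [_ fM]] := linfty_bounded f; have [N [_ gN]] := linfty_bounded g.
exists (M + 1 + (N + 1)) => _ [t _ <-]; rewrite (le_trans (ler_normB _ _))//.
by apply: lerD; [apply: fM | apply: gN] => //; rewrite ltrDl.
Qed.

Lemma le_linfty_dist f g t : `|f t - g t| <= linfty_dist f g.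
Proof. by apply: ub_le_sup; [exact: linfty_dist_has_ubound | exists t]. Qed.

Lemma linfty_dist_le f g (e : R) :
  0 <= e -> (forall t, `|f t - g t| <= e) -> linfty_dist f g <= e.
Proof.
move=> e0 fge; rewrite /linfty_dist /sup_norm.
have [->|/set0P A0] := eqVneq [set `|f t - g t| | t in [set: T]] set0.
  by rewrite sup0.
by apply: ge_sup => // _ [t _ <-].
Qed.

Lemma linfty_dist_ge0 f g : 0 <= linfty_dist f g.
Proof.
rewrite /linfty_dist /sup_norm.
have [->|/set0P[_ [t _ _]]] := eqVneq [set `|f t - g t| | t in [set: T]] set0.
  by rewrite sup0.
exact: le_trans (normr_ge0 _) (le_linfty_dist f g t).
Qed.

Lemma linfty_distxx f : linfty_dist f f = 0.
Proof.
apply/eqP; rewrite eq_le linfty_dist_ge0 andbT.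
by apply: linfty_dist_le => // t; rewrite subrr normr0.
Qed.

Lemma linfty_dist_eq0 f g : linfty_dist f g = 0 -> f = g.
Proof.
move=> fg0; have fg : linfty_fun f = g.
  apply/funext => t; apply/eqP; rewrite -subr_eq0 -normr_le0 -fg0.
  exact: le_linfty_dist.
case: f g fg {fg0} => f bf [g bg] /= fg.
by case: _ / fg bg => bg; rewrite (Prop_irrelevance bf bg).
Qed.

Lemma linfty_dist_sym f g : linfty_dist f g = linfty_dist g f.
Proof.
by rewrite /linfty_dist /sup_norm; under eq_imagel do rewrite distrC.
Qed.

Lemma linfty_dist_triangle g f h :
  linfty_dist f h <= linfty_dist f g + linfty_dist g h.
Proof.
apply: linfty_dist_le => [|t]; first by rewrite addr_ge0// linfty_dist_ge0.
by rewrite (le_trans (ler_distD (g t) _ _))// lerD// le_linfty_dist.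
Qed.

HB.instance Definition _ := gen_eqMixin (linfty T R).
HB.instance Definition _ := gen_choiceMixin (linfty T R).
HB.instance Definition _ := @isMetric.Build R (linfty T R) linfty_dist
  linfty_distxx linfty_dist_eq0 linfty_dist_sym linfty_dist_triangle.

End linfty_metric.

Section nonmeasurable_probability.
Context d (Omega : measurableType d) (R : realType) (P : probability Omega R).
Local Open Scope ereal_scope.

Definition inner_prob (A : set Omega) : \bar R :=
  ereal_sup [set P B | B in [set B | measurable B /\ B `<=` A]].

Definition outer_prob (A : set Omega) : \bar R :=
  ereal_inf [set P B | B in [set B | measurable B /\ A `<=` B]].

(* The last condition says that the integral of [U] exists; the library
   integral is total and returns a junk value otherwise. *)
Definition outer_expectation (f : Omega -> \bar R) : \bar R :=
  ereal_inf [set \int[P]_w U w | U in [set U : Omega -> \bar R |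
    [/\ measurable_fun [set: Omega] U,
        forall w, f w <= U w &
        \int[P]_w U^\+ w < +oo \/ \int[P]_w U^\- w < +oo]]].

Definition borel_map (E : topologicalType) (X : Omega -> E) : Prop :=
  forall B : set E, <<s [set U : set E | open U] >> B -> measurable (X @^-1` B).

Definition tight_map (E : topologicalType) (X : Omega -> E) : Prop :=
  forall eps : R, (0 < eps)%R ->
    exists2 C : set E, compact C & (1 - eps)%:E <= P (X @^-1` C).

(* Weak convergence in the Hoffmann-Jorgensen sense: the [X N] are arbitrary
   maps. The limit is to be Borel measurable, which is asked for separately. *)
Definition weak_cvg (E : topologicalType) (X : nat -> Omega -> E)
    (Y : Omega -> E) : Prop :=
  forall f : E -> R, continuous f -> bounded_fun f ->
    outer_expectation (fun w => (f (X N w))%:E) @[N --> \oo]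
      --> \int[P]_w (f (Y w))%:E.

Definition enlargement (E : pseudoMetricType R) (C : set E) (delta : R) :
  set E := \bigcup_(x in C) ball x delta.

Definition asymptotically_tight (E : pseudoMetricType R)
    (X : nat -> Omega -> E) : Prop :=
  forall eps : R, (0 < eps)%R -> exists2 C : set E, compact C &
    forall delta : R, (0 < delta)%R ->
      (1 - eps)%:E
        <= limn_einf (fun N => inner_prob (X N @^-1` enlargement C delta)).

End nonmeasurable_probability.

Section excursion_sets.
Context (R : realType) (S : metricType R).
Implicit Types (mu g : S -> R) (f : S -> \bar R) (H A B : set (S -> \bar R)).
Local Open Scope ereal_scope.

Definition lower_set g f : set S := [set s | (g s)%:E < f s].
Definition upper_set g f : set S := [set s | f s < (g s)%:E].

Definition shift_down H (eta : R) : set (S -> \bar R) :=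
  [set k | exists h, exists e : R,
     [/\ H h, (0 <= e <= eta)%R & k = (fun s => h s - e%:E)]].
Definition shift_up H (eta : R) : set (S -> \bar R) :=
  [set k | exists h, exists e : R,
     [/\ H h, (0 <= e <= eta)%R & k = (fun s => h s + e%:E)]].

Definition level_set mu H : set S :=
  [set s | exists2 h, H h & (mu s)%:E = h s].

Definition u_minus mu H : set S :=
  \bigcap_(eta in [set eta : R | (0 < eta)%R])
    closure (level_set mu (shift_down H eta)).
Definition u_plus mu H : set S :=
  \bigcap_(eta in [set eta : R | (0 < eta)%R])
    closure (level_set mu (shift_up H eta)).

Definition limit_dom mu A B (eta : R) : set S :=
  closure (level_set mu (shift_down A eta)) `|`
  closure (level_set mu (shift_up B eta)).

Definition continuity_dom mu A B (eta : R) : set S :=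
  (closure (level_set mu (shift_down A eta)) `\` interior (u_minus mu A)) `|`
  (closure (level_set mu (shift_up B eta)) `\` interior (u_plus mu B)).

Definition esg (x : \bar R) : \bar R :=
  match x with
  | r%:E => (Num.sg r)%:E
  | +oo => 1
  | -oo => -1
  end.

(* The functional is only applied with [D] a set containing
   [level_set mu [set EFin \o c]] (see [level_set_limit_dom]), so that the
   restriction to points of [D] in the suprema is immaterial.
   [ereal_sup set0 = -oo]. *)
Definition T_stat mu (c : S -> R) (D : set S) (f : D -> R) : \bar R :=
  let L := [set s : D | level_set mu [set EFin \o c] (val s)] in
  maxe (ereal_sup [set (f s)%:E | s in L]) (ereal_sup [set (- f s)%:E | s in L]).

Lemma level_set_limit_dom mu A B (eta : R) : (0 <= eta)%R ->
  level_set mu A `|` level_set mu B `<=` limit_dom mu A B eta.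
Proof.
move=> eta0 s [[h Hh sh]|[h Hh sh]]; [left|right]; apply: subset_closure;
  by exists h => //; exists h, 0%R; split; rewrite ?lexx//;
    apply/funext => t; rewrite ?sube0 ?adde0.
Qed.

End excursion_sets.

Section assumptions.
Context (R : realType) (S : metricType R) d (Omega : measurableType d).
Context (P : probability Omega R) (mu : S -> R).
Context (muhat : nat -> Omega -> linfty S R) (tau : nat -> R).
Context (sigma : linfty S R).
Implicit Types (A B : set (S -> \bar R)) (eta : R).

Definition G_N (N : nat) (w : Omega) (s : S) : R :=
  (muhat N w s - mu s) / (tau N * sigma s).

Definition A1_i A B eta (G : Omega -> linfty (limit_dom mu A B eta) R) : Prop :=
  [/\ tight_map P G, borel_map G &
      exists2 X : nat -> Omega -> linfty (limit_dom mu A B eta) R,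
        forall N w s, X N w s = G_N N w (val s) & weak_cvg P X G].

Definition A1_ii A B eta : Prop :=
  exists K : R, exists Z : nat -> Omega -> linfty S R,
    [/\ 0 < K,
        asymptotically_tight P
          (fun N w => inf [set (tau N)^-1 * Z N w s | s in [set: S]]) &
        forall N, inner_prob P [set w |
          (forall a, A a -> forall s,
             ~ closure (level_set mu (shift_down A eta)) s ->
             ((sigma s * (K + Z N w s))%:E <=
              ((muhat N w s)%:E - a s) * esg ((mu s)%:E - a s))%E) /\
          (forall b, B b -> forall s,
             ~ closure (level_set mu (shift_up B eta)) s ->
             ((sigma s * (K + Z N w s))%:E <=
              ((muhat N w s)%:E - b s) * esg ((mu s)%:E - b s))%E)] = 1%E].

Definition A1 A B eta (G : Omega -> linfty (limit_dom mu A B eta) R) : Prop :=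
  A1_i G /\ A1_ii A B eta.

(* Almost sure statements about nonmeasurable events: the complement lies in a
   measurable null set. *)
Definition A2 A B eta (G : Omega -> linfty (limit_dom mu A B eta) R) : Prop :=
  {ae P, forall w, {within
     [set s : limit_dom mu A B eta | continuity_dom mu A B eta (val s)],
     continuous (G w)}} /\
  forall N, {ae P, forall w,
     {within continuity_dom mu A B eta, continuous (G_N N w)}}.

End assumptions.

(* Main.v *)
Require Import Defs.
From HB Require Import structures.
From mathcomp Require Import all_boot all_order all_algebra.
From mathcomp Require Import all_classical all_reals all_analysis.
From mathcomp Require Import measurable_realfun lra.
Import Order.TTheory GRing.Theory Num.Theory.
Import numFieldNormedType.Exports.
Local Open Scope classical_set_scope.
Local Open Scope ring_scope.

(** Write [G_N = (muhat_N - mu) / (tau_N sigma)], [Z0] for the zero set of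
    [mu - c] and [D_delta] for the set where [|mu - c| <= delta]. The event
    says that [G_N <= q + (c - mu) / (tau_N sigma)] where [mu <= c], and
    symmetrically. It forces [|G_N| <= q] on [Z0], a closed condition, so the
    upper bound is the portmanteau theorem. Conversely [|G_N| <= q] on
    [D_delta], together with a uniform bound on [|G_N|] on the domain of [G]
    and the drift condition off that domain, implies the event for large [N],
    because [delta / tau_N] tends to infinity. Finally, compactness of [S] and
    continuity of [G] off the interior of [Z0] give
    [sup_(D_delta) |G| < q] for some [delta > 0] as soon as
    [sup_Z0 |G| < q]. *)

(** * Eventual bounds and extended limits superior and inferior *)

Section limn_esup_einf_near.
Context {R : realType}.
Implicit Types (u : (\bar R)^nat) (l : \bar R).
Local Open Scope ereal_scope.

Lemma limn_esup_le_near u l :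
  (\forall N \near \oo, u N <= l) -> limn_esup u <= l.
Proof.
move=> ul; rewrite /limn_esup limf_esupE; apply: ge_ereal_inf.
exists (ereal_sup (u @` [set N | u N <= l])).
  by exists [set N | u N <= l].
by apply/ereal_supP => _ [N uNl <-].
Qed.

Lemma limn_einf_ge_near u l :
  (\forall N \near \oo, l <= u N) -> l <= limn_einf u.
Proof.
move=> lu; rewrite /limn_einf leeNr; apply: limn_esup_le_near.
by apply: filterS lu => N; rewrite leeN2.
Qed.

Lemma lt_limn_einf_near u l :
  l < limn_einf u -> \forall N \near \oo, l < u N.
Proof.
rewrite /limn_einf lteNr /limn_esup limf_esupE => /ereal_inf_lt[_ [V FV <-]] Vl.
apply: filterS FV => N VN; rewrite -lteN2; apply: le_lt_trans Vl.
by apply: ereal_sup_ubound; exists N.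
Qed.

End limn_esup_einf_near.

(** * Calculus of inner and outer probability *)

Section inner_outer_probability.
Context {d} {Omega : measurableType d} {R : realType} (P : probability Omega R).
Implicit Types A B : set Omega.
Local Open Scope ereal_scope.

Lemma le_inner_prob A B : A `<=` B -> inner_prob P A <= inner_prob P B.
Proof.
move=> AB; apply: ereal_sup_le => _ [C [mC CA] <-].
by exists C => //; split => //; exact: subset_trans AB.
Qed.

Lemma le_outer_prob A B : A `<=` B -> outer_prob P A <= outer_prob P B.
Proof.
move=> AB; apply: ereal_inf_le_tmp => _ [C [mC BC] <-].
by exists C => //; split => //; exact: subset_trans BC.
Qed.

Lemma measurable_le_inner_prob A B :
  measurable A -> A `<=` B -> P A <= inner_prob P B.
Proof. by move=> mA AB; apply: ereal_sup_ubound; exists A. Qed.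

Lemma outer_prob_le_measurable A B :
  measurable B -> A `<=` B -> outer_prob P A <= P B.
Proof. by move=> mB AB; apply: ereal_inf_lbound; exists B. Qed.

(** Bonferroni's inequality for measurable subsets [A'], [B'] that come within [e / 2] of the two
    bounds, since [P (A' | B') <= 1] for the union. It lets several good events be intersected while
    their losses add up. *)
Lemma inner_probI A B (a b : R) :
  a%:E <= inner_prob P A -> b%:E <= inner_prob P B ->
  (a + b - 1)%:E <= inner_prob P (A `&` B).
Proof.
move=> aA bB; apply/lee_subgt0Pr => e e0; rewrite -EFinB.
have e20 : (0 < e / 2)%R by rewrite divr_gt0.
have [|_ [A' [mA' A'A] <-] aA'] :=
    @ereal_sup_gt _ [set P C | C in [set C | measurable C /\ C `<=` A]]
                    (a - e / 2)%:E.
  by apply: lt_le_trans aA; rewrite lte_fin ltrBlDr ltrDl.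
have [|_ [B' [mB' B'B] <-] bB'] :=
    @ereal_sup_gt _ [set P C | C in [set C | measurable C /\ C `<=` B]]
                    (b - e / 2)%:E.
  by apply: lt_le_trans bB; rewrite lte_fin ltrBlDr ltrDl.
apply: le_trans (@measurable_le_inner_prob (A' `&` B') _ _ _); last 2 first.
- exact: measurableI.
- exact: setISS.
have mI := measurableI _ _ mA' mB'.
have U1 : P (A' `|` B') <= 1 by apply: probability_le1; exact: measurableU.
have A'fin : P A' \is a fin_num by exact: fin_num_measure.
have B'fin : P B' \is a fin_num by exact: fin_num_measure.
have Ifin : P (A' `&` B') \is a fin_num by exact: fin_num_measure.
have UE : P (A' `|` B') = P A' + P B' - P (A' `&` B').
  by apply: measureUfinl => //; rewrite ltey_eq A'fin.
move: U1 aA' bB'; rewrite UE.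
rewrite -[P A']fineK// -[P B']fineK// -[P (_ `&` _)]fineK//.
by rewrite -EFinD !lee_fin !lte_fin; lra.
Qed.

Lemma inner_probC A (a : R) :
  outer_prob P A <= a%:E -> (1 - a)%:E <= inner_prob P (~` A).
Proof.
move=> Aa; apply/lee_subgt0Pr => e e0; rewrite -EFinB.
have [|_ [B [mB AB] <-] Ba] :=
    @ereal_inf_lt _ [set P C | C in [set C | measurable C /\ A `<=` C]]
                    (a + e)%:E.
  by apply: le_lt_trans Aa _; rewrite lte_fin ltrDl.
apply: le_trans (@measurable_le_inner_prob (~` B) _ _ _); last 2 first.
- exact: measurableC.
- exact: subsetC.
have PBfin : P B \is a fin_num by exact: fin_num_measure.
rewrite probability_setC//; move: Ba; rewrite -[P B]fineK//.
by rewrite -EFinB lee_fin lte_fin; lra.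
Qed.

(** Markov's inequality for each measurable majorant [U] of [f]: the set where [U >= 1] is
    measurable and covers [A]. *)
Lemma outer_prob_le_expectation A (f : Omega -> \bar R) :
  (forall w, 0 <= f w) -> (forall w, A w -> 1 <= f w) ->
  outer_prob P A <= outer_expectation P f.
Proof.
move=> f0 f1; apply/ereal_infP => _ [U [mU fU _] <-].
have U0 w : 0 <= U w by exact: le_trans (f0 w) (fU w).
have -> : \int[P]_w U w = \int[P]_w `|U w|.
  by apply: eq_integral => w _; rewrite gee0_abs.
apply: le_trans (le_integral_abse P measurableT mU ltr01).
rewrite mul1e setTI; apply: outer_prob_le_measurable => [|w Aw].
  rewrite -[X in measurable X]setTI; apply: emeasurable_fun_c_infty => //.
  exact: measurableT_comp.
by rewrite /= gee0_abs//; exact: le_trans (f1 w Aw) (fU w).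
Qed.

End inner_outer_probability.

(** * Portmanteau bounds for sublevel sets of continuous functionals *)

Section borel_and_weak_convergence.
Context {d} {Omega : measurableType d} {R : realType} (P : probability Omega R).
Context {E : topologicalType}.
Implicit Types (X : nat -> Omega -> E) (Y : Omega -> E) (phi : E -> R).

Lemma borel_map_continuous_comp Y phi :
  borel_map Y -> continuous phi -> measurable_fun setT (phi \o Y).
Proof.
move=> bY /continuousP cphi.
apply: (measurability _ (RGenOpens.measurableE R)) => _ [_ [a [b ->] <-]].
rewrite setTI comp_preimage; apply: bY; apply: sub_sigma_algebra.
by apply: cphi; exact: interval_open.
Qed.

Lemma borel_map_sublevel Y phi t : borel_map Y -> continuous phi ->
  measurable [set w | phi (Y w) <= t].
Proof.
move=> bY cphi; rewrite -[X in measurable X]setTI.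
apply: (@measurable_fun_le _ _ _ _ (phi \o Y) (cst t)) => //.
exact: borel_map_continuous_comp.
Qed.

(** The events [F n] decrease to the limit event, so half of [e] pays for widening the level by
    [1 / (n + 1)]; the other half pays for the weak convergence of a continuous function squeezed
    between the two indicators. *)
Lemma outer_prob_sublevel_near X Y phi (t e : R) :
  weak_cvg P X Y -> borel_map Y -> continuous phi -> 0 < e ->
  \forall N \near \oo,
    (outer_prob P [set w | phi (X N w) <= t]%R <=
     P [set w | phi (Y w) <= t]%R + e%:E)%E.
Proof.
move=> XY bY cphi e0; have e20 : 0 < e / 2 by rewrite divr_gt0.
pose F n := [set w | phi (Y w) <= t + n.+1%:R^-1].
have mF n : measurable (F n) by exact: borel_map_sublevel.
have FE : \bigcap_n F n = [set w | phi (Y w) <= t].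
  apply/seteqP; split => [w Fw|w Yw n _] /=; last first.
    by apply: le_trans Yw _; rewrite lerDl invr_ge0.
  rewrite leNgt; apply/negP => /ltr_add_invr[n]; rewrite ltNge => /negP; apply.
  exact: Fw.
have PYfin : P [set w | phi (Y w) <= t] \is a fin_num.
  by rewrite fin_num_measure//; exact: borel_map_sublevel.
have lt_near (l : \bar R) : l \is a fin_num -> (l < l + (e / 2)%:E)%E.
  by move=> lfin; rewrite lteDl// lte_fin.
have [n Fn] : exists n, (P (F n) < P [set w | phi (Y w) <= t]%R + (e / 2)%:E)%E.
  have : P (F n) @[n --> \oo] --> P (\bigcap_n F n).
    apply: nonincreasing_cvg_mu => //.
    - by rewrite ltey_eq fin_num_measure.
    - exact: bigcapT_measurable.
    - move=> m n mn; apply/subsetPset => w Fnw; apply: le_trans Fnw _.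
      by rewrite lerD2l lef_pV2 ?posrE// ler_nat.
  rewrite FE => /(_ _ (open_ereal_lt' (lt_near _ PYfin)))[n _ Fn].
  by exists n; apply: Fn; rewrite /= leqnn.
(* Portmanteau with a continuous cutoff: [f] is 1 on [phi <= t] and 0 off
   [phi <= t + 1 / (n + 1)]. *)
pose f (x : E) : R := Num.max 0 (Num.min 1 (1 - n.+1%:R * (phi x - t))).
have f0 x : 0 <= f x by rewrite /f le_max lexx.
have f1 x : f x <= 1 by rewrite /f ge_max ler01 ge_min lexx.
have cf : continuous f.
  move=> x.
  apply: (@continuous_max R E (cst 0)
    (cst 1 \min (fun x => 1 - n.+1%:R * (phi x - t)))); first exact: cvg_cst.
  apply: (@continuous_min R E (cst 1)); first exact: cvg_cst.
  apply: cvgB; first exact: cvg_cst.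
  apply: cvgMl_tmp; apply: cvgB; [exact: cphi|exact: cvg_cst].
have bf : bounded_fun f.
  exists 1; split => // M M1 x _; rewrite /= ger0_norm//.
  by rewrite (le_trans (f1 x))// ltW.
have fF : (\int[P]_w (f (Y w))%:E <= P (F n))%E.
  rewrite -[F n]setIT -integral_indic//.
  apply: ge0_le_integral => //.
  - by move=> w _; rewrite lee_fin.
  - by apply/measurable_EFinP; exact: borel_map_continuous_comp.
  - by apply/measurable_EFinP; exact: measurable_indic.
  - move=> w _; rewrite lee_fin indicE.
    have [_|] := boolP (w \in F n); first exact: f1.
    move=> /negP; rewrite inE /F /= => /negP; rewrite -ltNge => tw.
    rewrite /f ge_max lexx ge_min; apply/orP; right.
    by rewrite subr_le0 -ler_pdivrMl// mulr1 lerBrDl ltW.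
have If : (\int[P]_w (f (Y w))%:E)%E \is a fin_num.
  rewrite ge0_fin_numE; last by apply: integral_ge0 => w _; rewrite lee_fin.
  by rewrite (le_lt_trans fF)// ltey_eq fin_num_measure.
have : \forall N \near \oo, (outer_expectation P (fun w => (f (X N w))%:E) <
    \int[P]_w (f (Y w))%:E + (e / 2)%:E)%E.
  exact: (XY f cf bf _ (open_ereal_lt' (lt_near _ If))).
apply: filterS => N XN.
apply: (@le_trans _ _ (outer_expectation P (fun w => (f (X N w))%:E))).
  apply: outer_prob_le_expectation => w; first by rewrite lee_fin.
  move=> /= Xt; rewrite lee_fin le_max; apply/orP; right.
  rewrite le_min lexx /= lerBrDr gerDl mulr_ge0_le0// subr_le0//.
apply: (le_trans (ltW XN)).
have -> : e%:E = ((e / 2)%:E + (e / 2)%:E)%E.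
  by rewrite -EFinD -splitr.
rewrite addeA; apply: leeD2r.
exact: le_trans fF (ltW Fn).
Qed.

(** Apply the outer bound to [- phi] at level [- t'] and pass to complements. The gap [t < t'] makes
    [phi <= t] disjoint from the closed set [t' <= phi]. *)
Lemma inner_prob_sublevel_near X Y phi (t t' e : R) :
  weak_cvg P X Y -> borel_map Y -> continuous phi -> t < t' -> 0 < e ->
  \forall N \near \oo,
    (P [set w | phi (Y w) <= t]%R - e%:E <=
     inner_prob P [set w | phi (X N w) <= t']%R)%E.
Proof.
move=> XY bY cphi tt' e0.
have cNphi : continuous (-%R \o phi) by move=> x; apply: cvgN; exact: cphi.
have mt := borel_map_sublevel Y _ t bY cphi.
have mt' := borel_map_sublevel Y _ (- t') bY cNphi.
have := outer_prob_sublevel_near _ _ _ (- t') e XY bY cNphi e0.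
apply: filterS => N.
have finP A : measurable A -> P A \is a fin_num.
  by move=> mA; rewrite fin_num_measure.
have : (P [set w | phi (Y w) <= t]%R <=
        P (~` [set w | - phi (Y w) <= - t']%R))%E.
  apply: le_measure; rewrite ?inE//; first exact: measurableC.
  by move=> w /= Yt; apply/negP; rewrite lerN2 -ltNge (le_lt_trans Yt).
rewrite probability_setC//= -[P [set w | phi _ <= _]]fineK ?finP//.
rewrite -[P [set w | - phi _ <= _]]fineK ?finP//.
rewrite -EFinB -EFinD lee_fin => Pt Xt'.
apply: le_trans (le_trans (inner_probC _ _ _ Xt') (le_inner_prob _ _ _ _)).
  by rewrite -EFinB lee_fin; lra.
by move=> w /= /negP; rewrite lerN2 -ltNge => /ltW.
Qed.

End borel_and_weak_convergence.

(** * Suprema over a subset as continuous functionals on [linfty] *)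

Section sup_on.
Context {T : Type} {R : realType}.
Implicit Types (A : set T) (f g : linfty T R).

(** A real supremum, hence 0 on the empty set, whereas a pointwise bound there is vacuous even for
    negative [r]. Empty [A] is therefore treated apart below. *)
Definition sup_on A f : R := sup [set `|f t| | t in A].

Lemma sup_on_has_ubound A f : has_ubound [set `|f t| | t in A].
Proof.
have [M [_ fM]] := linfty_bounded f; exists (M + 1) => _ [t _ <-].
by apply: fM => //; rewrite ltrDl.
Qed.

Lemma sup_on_leP A f r : A !=set0 ->
  sup_on A f <= r <-> forall t, A t -> `|f t| <= r.
Proof.
move=> [t0 At0]; split=> [fr t At|fr].
  apply: le_trans fr; apply: ub_le_sup; first exact: sup_on_has_ubound.
  by exists t.
by apply: ge_sup => [|_ [t At <-]]; [exists `|f t0|, t0|exact: fr].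
Qed.

Lemma sup_on_lipschitz A f g : A !=set0 ->
  sup_on A f <= sup_on A g + linfty_dist f g.
Proof.
move=> A0; apply/sup_on_leP => // t At.
rewrite -[f t](subrK (g t)) addrC (le_trans (ler_normD _ _))// lerD//.
  exact: (sup_on_leP _ _ _ A0).1 (lexx _) t At.
exact: le_linfty_dist.
Qed.

Lemma continuous_sup_on A : A !=set0 -> continuous (sup_on A).
Proof.
move=> A0 f; apply/(@cvgrPdist_lt _ _ _ (nbhs f) (nbhs_filter f)) => e e0.
apply: filterS (nbhsx_ballx f _ e0) => g; rewrite ballEmdist /= => fg.
have {}fg : linfty_dist f g < e by exact: fg.
rewrite ltr_norml; have := sup_on_lipschitz A f g A0.
have := sup_on_lipschitz A g f A0.
by rewrite [linfty_dist g f]linfty_dist_sym; lra.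
Qed.

Context {d} {Omega : measurableType d} (P : probability Omega R).
Implicit Types (X : nat -> Omega -> linfty T R) (Y : Omega -> linfty T R).

Lemma sup_on_set A Y r : A !=set0 ->
  [set w | forall t, A t -> `|Y w t| <= r] = [set w | sup_on A (Y w) <= r].
Proof. by move=> A0; apply/seteqP; split=> w /=; rewrite sup_on_leP. Qed.

Lemma measurable_norm_le_on A Y r : borel_map Y ->
  measurable [set w | forall t, A t -> `|Y w t| <= r].
Proof.
move=> bY; have [->|/set0P A0] := eqVneq A set0.
  rewrite [X in measurable X](_ : _ = setT) //.
  by apply/seteqP; split=> // w _ t [].
rewrite sup_on_set//; apply: borel_map_sublevel => //.
exact: continuous_sup_on.
Qed.

Lemma outer_prob_norm_le_on_near A X Y (r e : R) :
  weak_cvg P X Y -> borel_map Y -> 0 < e ->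
  \forall N \near \oo,
    (outer_prob P [set w | forall t, A t -> `|X N w t| <= r]%R <=
     P [set w | forall t, A t -> `|Y w t| <= r]%R + e%:E)%E.
Proof.
move=> XY bY e0; have [->|/set0P A0] := eqVneq A set0.
  near=> N; apply: (@le_trans _ _ (P setT)).
    by apply: outer_prob_le_measurable.
  rewrite [X in (_ <= P X + _)%E](_ : _ = setT); last first.
    by apply/seteqP; split=> // w _ t [].
  by rewrite leeDl// lee_fin ltW.
have := outer_prob_sublevel_near P _ _ _ r e XY bY (continuous_sup_on A A0) e0.
by apply: filterS => N; rewrite !sup_on_set.
Unshelve. all: by end_near. Qed.

Lemma inner_prob_norm_le_on_near A X Y (r r' e : R) :
  weak_cvg P X Y -> borel_map Y -> r < r' -> 0 < e ->
  \forall N \near \oo,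
    (P [set w | forall t, A t -> `|Y w t| <= r]%R - e%:E <=
     inner_prob P [set w | forall t, A t -> `|X N w t| <= r']%R)%E.
Proof.
move=> XY bY rr' e0; have [->|/set0P A0] := eqVneq A set0.
  near=> N; apply: (@le_trans _ _ (P setT)); last first.
    by apply: measurable_le_inner_prob => // w _ t [].
  rewrite [X in (P X - _ <= _)%E](_ : _ = setT); last first.
    by apply/seteqP; split=> // w _ t [].
  by rewrite leeBlDr// leeDl// lee_fin ltW.
have := inner_prob_sublevel_near P _ _ _ r r' e XY bY
  (continuous_sup_on A A0) rr' e0.
by apply: filterS => N; rewrite !sup_on_set.
Unshelve. all: by end_near. Qed.

End sup_on.

(** Continuity from below along [B n], whose union covers [A] up to a null set. It trades an index
    depending on the outcome for a deterministic one, at cost [e]. *)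
Lemma nondecreasing_ae_cover {d} {Omega : measurableType d} {R : realType}
    (P : probability Omega R) (A : set Omega) (B : nat -> set Omega) (e : R) :
  measurable A -> (forall n, measurable (B n)) -> nondecreasing_seq B ->
  {ae P, forall w, A w -> exists n, B n w} -> 0 < e ->
  exists n, (P A - e%:E <= P (B n))%E.
Proof.
move=> mA mB ndB [Z [mZ PZ0 AZ]] e0.
have mU : measurable (\bigcup_n B n) by exact: bigcup_measurable.
have PAU : (P A <= P (\bigcup_n B n))%E.
  rewrite -[leRHS]adde0 -PZ0.
  apply: le_trans (measureU2 _ mU mZ); apply: le_measure; rewrite ?inE//.
    exact: measurableU.
  move=> w Aw; have [[n Bnw]|nB] := pselect (exists n, B n w).
    by left; exists n.
  by right; apply: AZ => /(_ Aw).
have PUlt : (P (\bigcup_n B n) - e%:E < P (\bigcup_n B n))%E.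
  by rewrite lteBlDr// lteDl ?fin_num_measure// lte_fin.
have /(_ _ (open_ereal_gt' PUlt))[n _ Bn] :=
  nondecreasing_cvg_mu (mu := P) mB mU ndB.
exists n; apply: (@le_trans _ _ (P (\bigcup_n B n) - e%:E)%E).
  exact: leeB.
by apply/ltW/Bn => /=.
Qed.

(** * The zero set of [mu - c], its neighbourhoods and the statistic *)

Section single_target.
Context {R : realType} {S : metricType R} (mu c : S -> R).
Local Notation C := [set EFin \o c].

Lemma level_set_EFin s : level_set mu C s <-> mu s = c s.
Proof.
by split=> [[_ -> /= [->]]|sc]; last exists (EFin \o c) => //=; rewrite ?sc.
Qed.

Lemma continuous_gap : continuous mu -> continuous c ->
  continuous (fun s => `|mu s - c s|).
Proof.
move=> cmu cc s; apply: (@cvg_norm _ R^o).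
by apply: (@cvgB _ R^o); [exact: cmu|exact: cc].
Qed.

Lemma closed_near_level eta : continuous mu -> continuous c ->
  closed [set s | `|mu s - c s| <= eta].
Proof.
move=> cmu cc; apply: (@preimage_closed S R^o (fun s => `|mu s - c s|)
    [set x | x <= eta]);
  last exact: closed_le.
by move=> s _; exact: continuous_gap.
Qed.

Lemma level_set_shift_down eta :
  level_set mu (shift_down C eta) `<=` [set s | `|mu s - c s| <= eta].
Proof.
move=> s [_ [h [e [-> /andP[e0 ee] ->]]]] /= [->].
by rewrite addrAC subrr add0r normrN ger0_norm.
Qed.

Lemma level_set_shift_up eta :
  level_set mu (shift_up C eta) `<=` [set s | `|mu s - c s| <= eta].
Proof.
move=> s [_ [h [e [-> /andP[e0 ee] ->]]]] /= [->].
by rewrite addrAC subrr add0r ger0_norm.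
Qed.

(** The sets [|mu - c| <= eta] are closed, so closures keep the bound and [eta] tends to 0. It
    serves [u_minus] and [u_plus], whose interiors are cut out of [continuity_dom]. *)
Lemma bigcap_closure_near_level (F : R -> set S) :
  continuous mu -> continuous c ->
  (forall eta, F eta `<=` [set s | `|mu s - c s| <= eta]) ->
  \bigcap_(eta in [set eta : R | 0 < eta]) closure (F eta) `<=`
  [set s | mu s = c s].
Proof.
move=> cmu cc FE s Fs /=; apply/eqP; rewrite -subr_eq0 -normr_le0.
apply/ler_addgt0Pr => e e0; rewrite add0r.
have /closure_id clE := closed_near_level e cmu cc.
by have := closureS (FE e) (Fs e e0); rewrite -clE.
Qed.

Lemma limit_dom_level_set eta s :
  0 <= eta -> mu s = c s -> limit_dom mu C C eta s.
Proof.
by move=> eta0 sc; apply: level_set_limit_dom => //; left; apply/level_set_EFin.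
Qed.

Lemma T_stat_leP (D : set S) (f : D -> R) (q : R) :
  (T_stat mu c f <= q%:E)%E <->
  forall t : D, mu (val t) = c (val t) -> `|f t| <= q.
Proof.
rewrite /T_stat ge_max; split.
  move=> /andP[/ereal_supP fq /ereal_supP Nfq] t tc.
  rewrite ler_norml lerNl -!lee_fin; apply/andP; split.
    by apply: Nfq; exists t => //; apply/level_set_EFin.
  by apply: fq; exists t => //; apply/level_set_EFin.
move=> fq; apply/andP; split; apply/ereal_supP => _ [t /level_set_EFin tc <-];
  have := fq t tc; rewrite ler_norml lee_fin => /andP[]//.
by rewrite lerNl.
Qed.

(** Supplies a real level strictly below [q] even when the statistic is [-oo], as it is for an empty
    zero set. *)
Lemma T_stat_ltP (D : set S) (f : D -> R) (q : R) :
  (T_stat mu c f < q%:E)%E -> exists2 r, r < q & (T_stat mu c f <= r%:E)%E.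
Proof.
case: T_stat => [x| |] //=.
  by rewrite lte_fin => xq; exists ((x + q) / 2); rewrite ?lee_fin; lra.
by move=> _; exists (q - 1); [lra|exact: leNye].
Qed.

(* Compactness turns the strict bound on the zero set of [mu - c] into a
   uniform strict bound on a neighbourhood of it. *)
Lemma T_stat_lt_near (eta q : R) (f : limit_dom mu C C eta -> R) :
  compact [set: S] -> continuous mu -> continuous c -> 0 < eta ->
  {within [set s : limit_dom mu C C eta | continuity_dom mu C C eta (val s)],
     continuous f} ->
  (T_stat mu c f < q%:E)%E ->
  exists n, forall t : limit_dom mu C C eta,
    `|mu (val t) - c (val t)| <= n.+1%:R^-1 -> `|f t| <= q - n.+1%:R^-1.
Proof.
move=> cS cmu cc eta0 /subspace_continuousP cf /T_stat_ltP[r rq /T_stat_leP fr].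
have umE : u_minus mu C `<=` [set s | mu s = c s].
  exact: bigcap_closure_near_level cmu cc level_set_shift_down.
have upE : u_plus mu C `<=` [set s | mu s = c s].
  exact: bigcap_closure_near_level cmu cc level_set_shift_up.
have near_small e : 0 < e -> \forall n \near \oo, n.+1%:R^-1 < e :> R.
  by move=> e0; exact: near_infty_natSinv_lt (PosNum e0).
(* The midpoint leaves room above [r] for the continuity of [f] and room below [q] for the final
   margin [1 / (n + 1)]. *)
have rq2 : r < (r + q) / 2 by lra.
have cdist : continuous (fun s => `|mu s - c s|).
  exact: continuous_gap.
pose Q (n : nat) x := forall t : limit_dom mu C C eta, val t = x ->
  `|mu x - c x| <= n.+1%:R^-1 -> `|f t| <= (r + q) / 2.
(* Near-covering compactness: it suffices to prove [Q n y] for [y] near each [x] and [n] large. Off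
   the zero set, the gap stays bounded away from 0 near [x], so the premise of [Q] fails for large
   [n]. *)
have [] : \forall n \near \oo, [set: S] `<=` Q n.
  apply: ((compact_near_coveringP _).1 cS) => x _.
  have [xc|xc] := eqVneq (mu x) (c x); last first.
    have d0 : 0 < `|mu x - c x| by rewrite normr_gt0 subr_eq0.
    have d20 : 0 < `|mu x - c x| / 2 by rewrite divr_gt0.
    have ny : \forall y \near x, `|mu x - c x| / 2 < `|mu y - c y|.
      by apply: (cvgr_gt _ (cdist x)); rewrite ltr_pdivrMr// ltr_pMr// ltr1n.
    exists ([set y | `|mu x - c x| / 2 < `|mu y - c y|],
            [set n | n.+1%:R^-1 < `|mu x - c x| / 2]).
      by split; [exact: ny|exact: near_small].
    move=> [y n] [/= my mn] t _ yn; exfalso.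
    by have := le_lt_trans yn (lt_trans mn my); rewrite ltxx.
  have fr' (t : limit_dom mu C C eta) :
      mu (val t) = c (val t) -> `|f t| <= (r + q) / 2.
    by move=> /fr/le_trans; apply; exact: ltW.
  (* Inside the interior, all nearby points are zeros and the bound [r] applies directly; on the
     boundary, continuity of [f] at [x] is used. *)
  have [xi|xi] := pselect ((interior [set s | mu s = c s]) x).
    have ny : \forall y \near x, mu y = c y by exact: xi.
    exists ([set y | mu y = c y], setT).
      by split; [exact: ny|exact: filterT].
    by move=> [y n] [/= yc _] t ty _; apply: fr'; rewrite ty.
  have Dx : x \in limit_dom mu C C eta.
    by rewrite inE; apply: limit_dom_level_set => //; exact: ltW.
  pose x' : limit_dom mu C C eta := exist _ x Dx.
  have Ax' : continuity_dom mu C C eta x.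
    have := set_valP x'; move=> [|] ?; [left|right]; split => //.
      by move=> /(interiorS umE).
    by move=> /(interiorS upE).
  have ny : \forall t \near x', continuity_dom mu C C eta (val t) ->
      `|f t| < (r + q) / 2.
    have : \forall t \near x', continuity_dom mu C C eta (val t) ->
        `|f x' - f t| < (r + q) / 2 - r.
      have rq0 : 0 < (r + q) / 2 - r by lra.
      exact: (@cvgrPdist_lt _ _ _ _ _ f (f x')).1 (cf x' Ax') _ rq0.
    apply: filterS => t + At => /(_ At) ft.
    have := fr x' xc; rewrite -[f t](subrK (f x')).
    have := ler_normD (f t - f x') (f x'); rewrite [`|f t - _|]distrC; lra.
  (* Neighbourhoods in the subtype are traces of neighbourhoods in [S], where the covering argument
     takes place. *)
  have {}ny : \forall y \near x, forall t : limit_dom mu C C eta, val t = y ->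
      continuity_dom mu C C eta (val t) -> `|f t| < (r + q) / 2.
    case: ny => _ [/= [W oW <-] Wx WU].
    have := open_nbhs_nbhs (conj oW (Wx : W x)); apply: filterS => y Wy t ty.
    by apply: WU; move: Wy; rewrite -ty.
  exists ([set y | forall t : limit_dom mu C C eta, val t = y ->
      continuity_dom mu C C eta (val t) -> `|f t| < (r + q) / 2], setT).
    by split; [exact: ny|exact: filterT].
  move=> [y n] [/= fy _] t ty _.
  (* A nearby zero is bounded by [r]; any other point avoids both removed interiors, hence lies in
     [continuity_dom]. *)
  have [yc|yc] := pselect (mu y = c y); first by apply: fr'; rewrite ty.
  apply/ltW/fy => //.
  have nI (U : set S) : U `<=` [set s | mu s = c s] -> ~ interior U (val t).
    by move=> UE /interior_subset/UE; rewrite ty.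
  by have := set_valP t; move=> [|] ?; [left|right]; split => //; exact: nI.
move=> n0 _ Qn.
have [|n1 _ qn] := near_small ((q - r) / 2); first by lra.
pose n := maxn n0 n1.
exists n => t tn; apply: (@le_trans _ _ ((r + q) / 2)).
  by apply: (Qn n _ (val t)) => //=; rewrite leq_maxl.
have := qn n; rewrite /= leq_maxr => /(_ isT).
by move: n.+1%:R^-1 => y; lra.
Qed.

End single_target.

(** * The excursion event at a fixed outcome and index, with [m] as estimate *)

Section excursion_inclusions.
Context {R : realType} {S : metricType R} (mu c : S -> R).
Local Notation C := [set EFin \o c].
Context (m sigma : S -> R) (q tau o O eta : R).
Context (tau0 : 0 < tau) (o0 : 0 < o) (eta0 : 0 < eta).
Context (sigma_bnd : forall s, o < sigma s < O).

Definition excursion_inclusions :=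
  upper_set m (fun s => (c s + q * tau * sigma s)%:E)
    `<=` upper_set mu (EFin \o c) /\
  lower_set m (fun s => (c s - q * tau * sigma s)%:E)
    `<=` lower_set mu (EFin \o c).

Let g s := (m s - mu s) / (tau * sigma s).

Let tausigma_gt0 s : 0 < tau * sigma s.
Proof. by rewrite mulr_gt0//; have /andP[/(lt_trans o0)] := sigma_bnd s. Qed.

(** A zero of [mu - c] lies in neither excursion set of [mu], so both inclusions keep it out of the
    estimated sets; dividing by [tau * sigma s] bounds [g s] from both sides. *)
Lemma excursion_inclusions_norm_le s :
  excursion_inclusions -> mu s = c s -> `|g s| <= q.
Proof.
move=> [UU LL] sc; have ts := tausigma_gt0 s.
rewrite ler_norml ler_pdivlMr// ler_pdivrMr//; apply/andP; split.
  rewrite leNgt; apply/negP => h.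
  have := LL s; rewrite /lower_set /= !lte_fin sc ltxx => H.
  by suff: false by []; apply: H; move: h; rewrite sc mulrA; lra.
rewrite leNgt; apply/negP => h.
have := UU s; rewrite /upper_set /= !lte_fin sc ltxx => H.
by suff: false by []; apply: H; move: h; rewrite sc mulrA; lra.
Qed.

(* Off [limit_dom] the drift [K] wins; on [limit_dom] the bound [q] is needed
   only within [delta] of the zero set, since further away the gap [delta]
   dominates the deviation [M * tau * sigma]. *)
Lemma norm_le_excursion_inclusions (Z : S -> R) (K L M delta : R) :
  (forall s : limit_dom mu C C eta,
     `|mu (val s) - c (val s)| <= delta -> `|g (val s)| <= q) ->
  (forall s : limit_dom mu C C eta, `|g (val s)| <= M) ->
  (forall s, - L <= tau^-1 * Z s) ->
  (forall s, ~ closure (level_set mu (shift_down C eta)) s ->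
     ((sigma s * (K + Z s))%:E <=
      ((m s)%:E - (c s)%:E) * esg ((mu s)%:E - (c s)%:E))%E) ->
  (M + `|q|) * tau * O <= delta -> (L + `|q|) * tau <= K ->
  excursion_inclusions.
Proof.
move=> gq gM ZL drift Mdelta LK.
(* The two inclusions in contrapositive form. *)
have main s : (mu s <= c s -> m s <= c s + q * tau * sigma s) /\
              (c s <= mu s -> c s - q * tau * sigma s <= m s).
  have ts := tausigma_gt0 s; have /andP[os sO] := sigma_bnd s.
  (* The sign of [q] is arbitrary, so away from the zero set its term is controlled through the
     absolute value of [q]. *)
  have s0 := lt_trans o0 os.
  have : - (`|q| * (tau * sigma s)) <= q * (tau * sigma s)
                                    <= `|q| * (tau * sigma s).
    by rewrite -mulNr !ler_pM2r// lerNl -normrN ler_norm normrN ler_norm.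
  rewrite -!mulrA => /andP[qlow qup].
  have [Ds|nDs] := pselect (limit_dom mu C C eta s); last first.
    (* From [Z s >= - L * tau] and [(L + |q|) * tau <= K]. The factor [esg] is then 1 or -1, as
       zeros of [mu - c] belong to [limit_dom]. *)
    have qK : `|q| * (tau * sigma s) <= sigma s * (K + Z s).
      rewrite mulrA mulrC ler_pM2l//.
      by have := ZL s; rewrite ler_pdivlMl//; move: LK; rewrite mulrDl; lra.
    have := drift s (fun h => nDs (or_introl h)); rewrite -EFinB /= lee_fin.
    have [musc|musc|sc] := ltgtP (mu s) (c s).
    - by rewrite ltr0_sg ?subr_lt0// mulrN1; split=> ?; lra.
    - by rewrite gtr0_sg ?subr_gt0// mulr1; split=> ?; lra.
    - by exfalso; apply: nDs; apply: limit_dom_level_set sc; exact: ltW.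
  have Ds' : s \in limit_dom mu C C eta by rewrite inE.
  have bound r : `|g s| <= r ->
      - (r * (tau * sigma s)) <= m s - mu s <= r * (tau * sigma s).
    by rewrite ler_norml ler_pdivlMr// ler_pdivrMr// mulNr.
  have [small|large] := leP `|mu s - c s| delta.
    by have /bound/andP[] := gq (exist _ s Ds') small; split=> ?; lra.
  have gM' : `|g s| <= M := gM (exist _ s Ds').
  have /andP[Mlow Mup] := bound _ gM'.
  have : (M + `|q|) * (tau * sigma s) <= delta.
    apply: le_trans Mdelta; rewrite mulrA; apply: ler_wpM2l; last exact: ltW.
    by rewrite mulr_ge0 ?addr_ge0 ?(le_trans _ gM')// ltW.
  rewrite mulrDl => Mq; split=> musc.
    by move: large; rewrite ler0_norm ?subr_le0//; lra.
  by move: large; rewrite ger0_norm ?subr_ge0//; lra.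
split=> s; rewrite /upper_set /lower_set /= !lte_fin => ms;
  rewrite ltNge; apply/negP.
  by move=> /(main s).1; rewrite leNgt ms.
by move=> /(main s).2; rewrite leNgt ms.
Qed.

End excursion_inclusions.

(** * Control of the drift remainder, and the two asymptotic bounds *)

Lemma asymptotically_tight_lower_bound {d} {Omega : measurableType d}
    {R : realType} (P : probability Omega R) (X : nat -> Omega -> R) (e : R) :
  asymptotically_tight P X -> 0 < e ->
  exists L, \forall N \near \oo,
    ((1 - e)%:E <= inner_prob P [set w | - L <= X N w]%R)%E.
Proof.
move=> tX e0; have e20 : 0 < e / 2 by rewrite divr_gt0.
have [C /compact_bounded[L0 [_ CL]] tC] := tX _ e20.
(* One unit passes strictly beyond the bound [L0] of the compact set, the other is the radius of its
   enlargement. Tightness at [e / 2] gives the strict inequality needed to pass from the limit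
   inferior to large [N]. *)
exists (L0 + 1 + 1).
have /lt_limn_einf_near : ((1 - e)%:E < limn_einf (fun N =>
    inner_prob P (X N @^-1` enlargement C 1)))%E.
  by apply: lt_le_trans (tC 1 ltr01); rewrite lte_fin; lra.
apply: filterS => N /ltW/le_trans; apply; apply: le_inner_prob => w [x Cx].
have := CL (L0 + 1) _ x Cx; rewrite ltrDl ltr01 => /(_ isT) /=.
by rewrite /ball /= ler_norml ltr_norml => /andP[? _] /andP[? ?]; lra.
Qed.

Lemma inf_scaled_le {T : Type} {R : realType} (a : R) (z : linfty T R) (t : T) :
  inf [set a * z s | s in [set: T]] <= a * z t.
Proof.
apply: ge_inf; last by exists t.
have [M [_ zM]] := linfty_bounded z; exists (- (`|a| * (M + 1))) => _ [s _ <-].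
rewrite lerNl; apply: le_trans (ler_norm _) _; rewrite normrN normrM.
by rewrite ler_wpM2l//; apply: zM => //; rewrite ltrDl.
Qed.

Theorem corollary3 (R : realType) (S : metricType R) (d : measure_display)
  (Omega : measurableType d) (P : probability Omega R)
  (mu c : S -> R) (q : R)
  (muhat : nat -> Omega -> linfty S R) (tau : nat -> R) (sigma : linfty S R)
  (o O eta : R)
  (G : Omega ->
       linfty (limit_dom mu [set EFin \o c] [set EFin \o c] eta) R) :
  compact [set: S] ->
  continuous mu -> continuous c ->
  (forall N, 0 < tau N) -> tau N @[N --> \oo] --> (0 : R) ->
  0 < o -> (forall s, o < sigma s < O) ->
  0 < eta ->
  A1 P muhat tau sigma G ->
  A2 P muhat tau sigma G ->
  let event N := [set w : Omega |
    upper_set (muhat N w) (fun s => (c s + q * tau N * sigma s)%:E)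
      `<=` upper_set mu (EFin \o c) /\
    lower_set (muhat N w) (fun s => (c s - q * tau N * sigma s)%:E)
      `<=` lower_set mu (EFin \o c)] in
  (P [set w | T_stat mu c (G w) < q%:E] <=
     limn_einf (fun N => inner_prob P (event N)))%E /\
  (limn_esup (fun N => outer_prob P (event N)) <=
     P [set w | T_stat mu c (G w) <= q%:E])%E.
Proof.
move=> cS cmu cc tau0 tau_cvg o0 sigma_bnd eta0.
move=> [[_ bG [X XE XG]] [K [Z [K0 Ztight Zae]]]] [cG _] event.
set D := limit_dom _ _ _ _ in G X XE XG bG cG *.
pose A0 := [set t : D | mu (val t) = c (val t)].
have T_leE r : [set w | (T_stat mu c (G w) <= r%:E)%E] =
    [set w | forall t, A0 t -> `|G w t| <= r].
  by apply/seteqP; split=> w /T_stat_leP.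
have mT_le r : measurable [set w | (T_stat mu c (G w) <= r%:E)%E].
  by rewrite T_leE; exact: measurable_norm_le_on.
(* The strict event is a countable union of the closed events at the levels [q - 1 / (n + 1)]. *)
have mT_lt : measurable [set w | (T_stat mu c (G w) < q%:E)%E].
  rewrite (_ : mkset _ = \bigcup_n
      [set w | (T_stat mu c (G w) <= (q - n.+1%:R^-1)%:E)%E]).
    exact: bigcup_measurable.
  apply/seteqP; split=> w /=.
    move=> /T_stat_ltP[r /ltr_add_invr[n rn] Tr].
    exists n => //=; apply: le_trans Tr _; rewrite lee_fin.
    by move: rn; move: n.+1%:R^-1 => y; lra.
  move=> [n _ /=] /le_lt_trans; apply; rewrite lte_fin ltrBlDr ltrDl.
  by rewrite invr_gt0.
split; last first.
  apply/lee_addgt0Pr => e e0; apply: limn_esup_le_near.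
  have := outer_prob_norm_le_on_near P A0 X G q e XG bG e0.
  rewrite -T_leE; apply: filterS => N /(le_trans _); apply.
  apply: le_outer_prob => w ev t tc; rewrite XE.
  by apply: (excursion_inclusions_norm_le _ _ _ _ _ _ o O) ev tc.
apply/lee_subgt0Pr => e e0; apply: limn_einf_ge_near.
(* Five losses of [e6] occur: choosing [n], choosing [M], weak convergence for each of them, and
   tightness of the remainder. The drift event has inner probability 1. *)
pose e6 := e / 6; have e60 : 0 < e6 by rewrite divr_gt0.
pose A n := [set t : D | `|mu (val t) - c (val t)| <= n.+1%:R^-1].
have le_inv m n : (m <= n)%N -> n.+1%:R^-1 <= m.+1%:R^-1 :> R.
  by move=> mn; rewrite lef_pV2 ?posrE// ler_nat.
(* For almost every outcome, [T_stat_lt_near] provides some [n]; one fixed [n] works up to [e6]. *)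
have [n Bn] : exists n, (P [set w | (T_stat mu c (G w) < q%:E)%E] - e6%:E <=
    P [set w | forall t, A n t -> `|G w t| <= q - n.+1%:R^-1]%R)%E.
  apply: nondecreasing_ae_cover => //.
  - by move=> n; exact: measurable_norm_le_on.
  - move=> m n mn; apply/subsetPset => w Gm t At.
    apply: (@le_trans _ _ (q - m.+1%:R^-1)); last by rewrite lerB// le_inv.
    by apply: Gm; apply: le_trans At (le_inv _ _ mn).
  - apply: filterS cG => w cGw.
    exact: (T_stat_lt_near _ _ _ _ _ cS cmu cc eta0 cGw).
(* Every path of [G] is bounded, so the events with integer bounds exhaust [Omega]. *)
have [M BM] : exists M : nat, (P [set: Omega] - e6%:E <=
    P [set w | forall t : D, setT t -> `|G w t| <= M%:R]%R)%E.
  apply: nondecreasing_ae_cover => //.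
  - by move=> M; exact: measurable_norm_le_on.
  - move=> m k mk; apply/subsetPset => w Gm t At.
    by apply: le_trans (Gm t At) _; rewrite ler_nat.
  - apply: aeW => w _; have [M [_ GM]] := linfty_bounded (G w).
    exists (Num.truncn (M + 1)).+1 => t _.
    apply: le_trans (ltW (truncnS_gt (M + 1))).
    by apply: GM => //; rewrite ltrDl.
have [L BL] := asymptotically_tight_lower_bound _ _ _ Ztight e60.
have tau_small a b : 0 < b -> \forall N \near \oo, a * tau N <= b.
  move=> b0; have : a * tau N @[N --> \oo] --> a * 0 by exact: cvgMl_tmp.
  rewrite mulr0 => /cvgr_le; exact.
have n0 : 0 < n.+1%:R^-1 :> R by rewrite invr_gt0.
near=> N.
(* The margins [1 / (n + 1)] here and 1 in [XM] are the strict gaps between levels that the inner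
   portmanteau bound requires. *)
have XB :
  (P [set w | forall t, A n t -> `|G w t| <= q - n.+1%:R^-1]%R - e6%:E <=
    inner_prob P [set w | forall t, A n t -> `|X N w t| <= q]%R)%E.
  by near: N; apply: inner_prob_norm_le_on_near => //; rewrite ltrBlDr ltrDl.
have XM : (P [set w | forall t : D, setT t -> `|G w t| <= M%:R]%R - e6%:E <=
    inner_prob P [set w | forall t : D, setT t -> `|X N w t| <= M%:R + 1]%R)%E.
  by near: N; apply: inner_prob_norm_le_on_near => //; rewrite ltrDl.
have ZL : ((1 - e6)%:E <= inner_prob P [set w |
    - L <= inf [set (tau N)^-1 * Z N w s | s in [set: S]]]%R)%E by near: N.
have Mdelta : (M%:R + 1 + `|q|) * O * tau N <= n.+1%:R^-1.
  by near: N; exact: tau_small.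
have LK : (L + `|q|) * tau N <= K by near: N; exact: tau_small.
have XB' : ((fine (P [set w | (T_stat mu c (G w) < q%:E)%E]) - (e6 + e6))%:E <=
    inner_prob P [set w | forall t, A n t -> `|X N w t| <= q]%R)%E.
  apply: le_trans XB; rewrite EFinB EFinD fineK ?fin_num_measure//.
  by rewrite fin_num_oppeD// addeA leeB.
have XM' : ((1 - (e6 + e6))%:E <=
    inner_prob P [set w | forall t : D, setT t -> `|X N w t| <= M%:R + 1]%R)%E.
  apply: le_trans XM; rewrite EFinB EFinD fin_num_oppeD// addeA leeB//.
  by rewrite -(@probability_setT _ _ _ P).
have /eqP := Zae N; rewrite eq_le => /andP[_ Zae1].
(* On the intersection of the four events the deterministic inclusion lemma applies, with
   [delta = 1 / (n + 1)]. *)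
have := inner_probI _ _ _ _ _ (inner_probI _ _ _ _ _ XB' XM')
  (inner_probI _ _ _ _ _ ZL Zae1).
rewrite -[P [set w | (T_stat _ _ _ < _)%E]]fineK ?fin_num_measure// => H.
apply: le_trans (le_trans H _).
  by rewrite -EFinB lee_fin /e6; lra.
apply: le_inner_prob => w [[/= wA wM] [/= wL [wdrift _]]].
apply: (@norm_le_excursion_inclusions R S mu c (muhat N w) sigma q (tau N)
  o O eta _ _ _ _ (Z N w) K L (M%:R + 1) n.+1%:R^-1) => //.
- by move=> t tn; have := wA t tn; rewrite XE.
- by move=> t; have := wM t I; rewrite XE.
- by move=> s; apply: le_trans wL (inf_scaled_le _ _ _).
- by move=> s; exact: (wdrift (EFin \o c) erefl s).
- by rewrite mulrAC.
Unshelve. all: end_near. Qed.
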